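(* Let $0.85798\leq\omega\leq1$. For every $N$-qubit quantum state $\rho_{AB_1\cdots B_{N-1}}$, $$\mathfrak{C}_\omega^a(\rho_{A|B_1\cdots B_{N-1}})\leq\mathfrak{C}_\omega^a(\rho_{AB_1})+\cdots+\mathfrak{C}_\omega^a(\rho_{AB_{N-1}}),$$ where $\mathfrak{C}_\omega^a(\rho_{A|B_1\cdots B_{N-1}})$ is the $G_\omega$-concurrence of assistance of $\rho_{AB_1\cdots B_{N-1}}$ in the bipartition $A|B_1\cdots B_{N-1}$, and $\rho_{AB_{j-1}}$ is the reduced density matrix on the subsystem $AB_{j-1}$, $j=2,3,\ldots,N$.
   Context: For $0<\omega\leq1$ the $G_\omega$-concurrence of a bipartite pure state $|\varphi\rangle_{XY}$ is $\mathfrak{C}_\omega(|\varphi\rangle_{XY})=[\mathrm{tr}(\rho_X^\omega)-1]^\omega$ with $\rho_X=\mathrm{tr}_Y(|\varphi\rangle_{XY}\langle\varphi|)$ (with $0^\omega=0$ on the kernel of $\rho_X$). The $G_\omega$-concurrence of assistance of a bipartite state $\rho_{XY}$ is $\mathfrak{C}^a_\omega(\rho_{XY})=\max\sum_i p_i\,\mathfrak{C}_\omega(|\varphi_i\rangle_{XY})$, the maximum being over all pure state decompositions $\rho_{XY}=\sum_i p_i|\varphi_i\rangle\langle\varphi_i|$. For an $N$-qubit state ($N\ge2$), the bipartition $A|B_1\cdots B_{N-1}$ means $X=A$ and $Y=B_1\cdots B_{N-1}$. *)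

(* Defs.v *)
(* The basis vector |x>|y> of C^m (x) C^n is indexed by                       *)
(* [mxtens_index (x, y)], as for the Kronecker product [*t] of [mxtens].      *)
From mathcomp Require Import all_boot all_order all_algebra spectral.
From mathcomp Require Import all_classical all_reals all_analysis.
From mathcomp Require Import complex mxtens.

Set Implicit Arguments.
Unset Strict Implicit.
Unset Printing Implicit Defensive.

Import Order.TTheory GRing.Theory Num.Theory.
Local Open Scope classical_set_scope.
Local Open Scope ring_scope.
Local Open Scope complex_scope.
Local Open Scope sesquilinear_scope.

Definition density (R : realType) (n : nat) (rho : 'M[R[i]]_n) : Prop :=
  [/\ rho \is hermsymmx,
      forall v : 'cV[R[i]]_n, 0 <= (v^t* *m rho *m v) 0 0
    & \tr rho = 1].

Definition unit_vector (R : realType) (n : nat) (phi : 'cV[R[i]]_n) : Prop :=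
  (phi^t* *m phi) 0 0 = 1.

Definition ket_bra (R : realType) (n : nat) (phi : 'cV[R[i]]_n) : 'M[R[i]]_n :=
  phi *m phi^t*.

Definition ptraceY (R : realType) (m n : nat) (rho : 'M[R[i]]_(m * n)) :
    'M[R[i]]_m :=
  \matrix_(x, x') \sum_(y < n) rho (mxtens_index (x, y)) (mxtens_index (x', y)).

(* Spectral functional calculus; meaningful for positive semidefinite [A],    *)
(* whose spectrum is real and nonnegative. For [w != 0], [0 `^ w = 0].        *)
Definition mxpowR (R : realType) (n : nat) (A : 'M[R[i]]_n) (w : R) :
    'M[R[i]]_n :=
  invmx (spectralmx A)
    *m diag_mx (map_mx (fun z => (complex.Re z `^ w)%:C) (spectral_diag A))
    *m spectralmx A.

Definition G_concurrence (R : realType) (w : R) (m n : nat)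
    (phi : 'cV[R[i]]_(m * n)) : R :=
  (complex.Re (\tr (mxpowR (ptraceY (ket_bra phi)) w)) - 1) `^ w.

Definition pure_decomposition (R : realType) (n : nat) (rho : 'M[R[i]]_n)
    (k : nat) (p : 'I_k -> R) (phi : 'I_k -> 'cV[R[i]]_n) : Prop :=
  [/\ forall i, 0 <= p i,
      \sum_i p i = 1,
      forall i, unit_vector (phi i)
    & rho = \sum_i (p i)%:C *: ket_bra (phi i)].

(* The supremum is over a bounded set, nonempty when [rho] is a density       *)
(* matrix, and is then a maximum: by convexity, decompositions of bounded     *)
(* length suffice, and these form a compact set.                              *)
Definition G_concurrence_assist (R : realType) (w : R) (m n : nat)
    (rho : 'M[R[i]]_(m * n)) : R :=
  sup [set s : R | exists (k : nat) (p : 'I_k -> R)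
                          (phi : 'I_k -> 'cV[R[i]]_(m * n)),
         pure_decomposition rho p phi /\
         s = \sum_i p i * G_concurrence w (phi i)].

(* Dimension of the space of qubits B_0, ..., B_(n-1), whose computational    *)
(* basis is indexed by bit strings through [enum_rank].                       *)
Definition qdim (n : nat) : nat := #|{ffun 'I_n -> 'I_2}|.

Definition AB_index (n : nat) (a : 'I_2) (b : {ffun 'I_n -> 'I_2}) :
    'I_(2 * qdim n) :=
  mxtens_index (a, enum_rank b).

Definition set_bit (n : nat) (b : {ffun 'I_n -> 'I_2}) (j : 'I_n) (c : 'I_2) :
    {ffun 'I_n -> 'I_2} :=
  [ffun k => if k == j then c else b k].

(* Partial trace over all B_k with k != j: the sum over [b] with [b j = c]    *)
(* ranges over the values of the traced-out bits.                             *)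
Definition reduced_AB (R : realType) (n : nat) (rho : 'M[R[i]]_(2 * qdim n))
    (j : 'I_n) : 'M[R[i]]_(2 * 2) :=
  \matrix_(u, v)
    let: (a, c) := mxtens_unindex u in
    let: (a', c') := mxtens_unindex v in
    \sum_(b : {ffun 'I_n -> 'I_2} | b j == c)
       rho (AB_index a b) (AB_index a' (set_bit b j c')).

(* Main.v *)
(* Write K(x) for the G_w-concurrence of a qubit state with eigenvalues       *)
(* (1 -+ sqrt (1 - x)) / 2, so that a pure state phi of qubit A with any      *)
(* system has concurrence K(tangle phi), where the tangle is 4 det rho_A.     *)
(* For 0 < w <= 1 the map K is nondecreasing and subadditive on x >= 0: the   *)
(* function tr rho^w - 1 is concave in det rho, and x |-> x^w is subadditive. *)
(*                                                                            *)
(* For a pure phi on A B_1 ... B_n let T_j be the symmetric matrix of the     *)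
(* spin-flip form on the conditional states of A B_j.  Then                   *)
(*   tangle phi <= \sum_j |T_j|^2   (Hilbert-Schmidt norm),                   *)
(* by a Poincare-type inequality on pairs of bit strings for the commuting    *)
(* swaps of the j-th bits.  Moreover rho_{A B_j} has a pure state             *)
(* decomposition all of whose members have tangle >= |T_j|^2.  Hence          *)
(*   K(tangle phi) <= \sum_j K(|T_j|^2) <= \sum_j C^a_w(rho_{A B_j}),         *)
(* and the mixed case follows by merging decompositions.                      *)
(*                                                                            *)
(* Since all members have at least the same tangle, no convexity of K as a    *)
(* function of the concurrence enters.                                        *)
Require Import Defs.
From mathcomp Require Import all_boot all_order all_algebra spectral.
From mathcomp Require Import all_classical all_reals all_analysis.
From mathcomp Require Import complex mxtens.
From mathcomp Require Import ring lra.

Set Implicit Arguments.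
Unset Strict Implicit.
Unset Printing Implicit Defensive.

Import Order.TTheory GRing.Theory Num.Theory.
Import numFieldNormedType.Exports.
Local Open Scope classical_set_scope.
Local Open Scope ring_scope.
Local Open Scope complex_scope.
Local Open Scope sesquilinear_scope.

(** * The concurrence as a function of the tangle *)

(** Three independent ingredients carry the proof. Analytic, [tangle_GD]: with q = tr rho^w - 1, the
    ratio q / det is nonincreasing ([qubit_trpow_ratio_nincr]), so q is subadditive in the tangle,
    and the power w preserves this. Algebraic, [high_tangle_decomposition]: some ensemble of rho_{A
    B_j} has spin-flip values summing to |T_j| ([ket_bra_form_decomposition]), and real rotations of
    pairs of members then make every member reach its share ([rotate_nonneg]). Combinatorial,
    [tangle_le_sum_AB]: the minors of the amplitude matrix are antisymmetric in the two bit strings;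
    exchanging the strings is a product of single-bit swaps, and the defects under the j-th swap are
    the entries of T_j. [G_concurrence_tangle] passes from concurrence to tangle, and
    [mixture_le_assist] merges ensembles into a lower bound on the supremum. *)

Lemma slope_nincr (R : realType) (f df g dg : R -> R) (x y z t : R) :
    x < y -> y <= z -> z < t ->
    {within `[x, t], continuous f} -> {within `[x, t], continuous g} ->
    (forall u, u \in `]x, t[ -> is_derive u 1 f (df u)) ->
    (forall u, u \in `]x, t[ -> is_derive u 1 g (dg u)) ->
    (forall u, u \in `]x, t[ -> dg u != 0) ->
    (forall u v, x < u -> u < v -> v < t -> df v / dg v <= df u / dg u) ->
  (f t - f z) / (g t - g z) <= (f y - f x) / (g y - g x).
Proof.
move=> xy yz zt cf cg fdf gdg dg0 mono.
have xt : x <= t by lra.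
have yt : y <= t by lra.
have xz : x <= z by lra.
have sub1 : `[x, y] `<=` `[x, t].
  by apply: subset_itvl; rewrite bnd_simp.
have sub2 : `[z, t] `<=` `[x, t].
  by apply: subset_itvr; rewrite bnd_simp.
(* By Cauchy's mean value theorem each chord ratio is a value of [df / dg], at a point of []x, y[]
   and at a point of []z, t[]; the former lies to the left. *)
have cauchy p q : x <= p -> p < q -> q <= t -> `[p, q] `<=` `[x, t] ->
    exists2 c, c \in `]p, q[ & df c / dg c = (f q - f p) / (g q - g p).
  move=> xp pq qt sub.
  have in_xt u : u \in `]p, q[ -> u \in `]x, t[.
    by rewrite !in_itv /=; lra.
  exact: (@cauchy_MVT R f df g dg p q pq (continuous_subspaceW sub cf)
    (continuous_subspaceW sub cg) (fun u pu => fdf u (in_xt u pu))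
    (fun u pu => gdg u (in_xt u pu)) (fun u pu => dg0 u (in_xt u pu))).
have [c cxy Ec] := cauchy x y (lexx x) xy yt sub1.
have [d dzt Ed] := cauchy z t xz zt (lexx t) sub2.
move: cxy dzt; rewrite !in_itv /= => cxy dzt.
have eqle (p q : R) : p = q -> p <= q by move=> ->.
apply: le_trans (eqle _ _ (esym Ed)) (le_trans _ (eqle _ _ Ec)).
by apply: mono; lra.
Qed.

Lemma le0_powR_nincr (R : realType) (r x y : R) :
  r <= 0 -> 0 < x -> x <= y -> y `^ r <= x `^ r.
Proof.
move=> r0 x0 xy; rewrite -(opprK r) !(powRN _ (- r)).
have y0 : 0 < y by lra.
rewrite lef_pV2 ?posrE ?powR_gt0//.
by apply: ge0_ler_powR => //; rewrite ?nnegrE; lra.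
Qed.

Lemma is_derive1_continuous (R : realType) (f : R -> R) (u d : R) :
  is_derive u 1 f d -> f @ u --> f u.
Proof.
move=> fd; apply: differentiable_continuous; apply/derivable1_diffP.
exact: (@ex_derive _ _ _ _ _ _ _ fd).
Qed.

Lemma is_derive1_onem_powR (R : realType) (r u : R) : u < 1 ->
  is_derive u 1 (fun v : R => (1 - v) `^ r) (- (r * (1 - u) `^ (r - 1))).
Proof.
move=> u1; rewrite -[X in is_derive _ _ _ X]mulrN1.
have d1u : is_derive u 1 (fun u : R => 1 - u) (-1).
  by apply: is_derive_eq; rewrite add0r mul1r.
apply: (@is_derive1_comp _ (fun v : R => v `^ r) (fun u : R => 1 - u)) => //.
by apply: is_derive1_powR; lra.
Qed.

(** [[c, d]] and [[1 - d, 1 - c]] have the same length and the second lies to the right, so the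
    convex function u^r drops less on it. *)
Lemma powR_convex_gap (R : realType) (r c d : R) :
    r <= 0 -> 0 < c -> c < d -> d <= 1 - d ->
  (1 - d) `^ r - (1 - c) `^ r <= d `^ r * (-1) + c `^ r.
Proof.
move=> r0 c0 cd d1.
have := @slope_nincr R (fun u => - u `^ r) (fun u => - (r * u `^ (r - 1)))
  id (fun=> 1) c d (1 - d) (1 - c).
rewrite (_ : 1 - c - (1 - d) = d - c); last by lra.
rewrite ler_pM2r; last by rewrite invr_gt0; lra.
move=> H; suff: - (1 - c) `^ r - - (1 - d) `^ r <= - d `^ r - - c `^ r by lra.
apply: H => //; try lra.
- apply: continuous_in_subspaceT => u; rewrite inE /= in_itv /= => ?.
  apply: (@is_derive1_continuous _ _ _ (- (r * u `^ (r - 1)))).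
  by apply: is_deriveN; apply: is_derive1_powR; lra.
- by apply: continuous_subspaceT => u; exact: cvg_id.
- move=> u; rewrite in_itv /= => ?; apply: is_deriveN.
  by apply: is_derive1_powR; lra.
- move=> u v cu uv vt; rewrite !divr1 -!mulNr.
  apply: ler_wpM2l; first by lra.
  by apply: le0_powR_nincr; lra.
Qed.

(** The function u^r - (1 - u)^r is convex on ]0, 1/2[ and vanishes at 1/2; up to a factor -1/2 both
    ratios are slopes of its chords ending at 1/2. *)
Lemma powR_diff_ratio_nincr (R : realType) (r c d : R) :
    r <= 0 -> 0 < c -> c < d -> d < 1 / 2 ->
  (d `^ r - (1 - d) `^ r) / (1 - 2 * d) <= (c `^ r - (1 - c) `^ r) / (1 - 2 * c).
Proof.
move=> r0 c0 cd d1.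
have := @slope_nincr R (fun u => (1 - u) `^ r - u `^ r)
  (fun u => - (r * (1 - u) `^ (r - 1)) - r * u `^ (r - 1))
  id (fun=> 1) c d d (1 / 2).
set hc := c `^ r - _; set hd := d `^ r - _.
have -> : (1 - 1 / 2 : R) = 1 / 2 by lra.
rewrite subrr sub0r (_ : - ((1 - d) `^ r - d `^ r) = hd); last first.
  by rewrite /hd; lra.
rewrite (_ : _ - _ - _ = hc - hd); last by rewrite /hc /hd; lra.
move=> H.
have {H} : hd / (1 / 2 - d) <= (hc - hd) / (d - c).
  apply: H => //.
  - apply: continuous_in_subspaceT => u; rewrite inE /= in_itv /= => ?.
    apply: (@is_derive1_continuous _ _ _
      (- (r * (1 - u) `^ (r - 1)) - r * u `^ (r - 1))).
    apply: is_deriveB; first by apply: is_derive1_onem_powR; lra.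
    by apply: is_derive1_powR; lra.
  - by apply: continuous_subspaceT => u; exact: cvg_id.
  - move=> u; rewrite in_itv /= => ?.
    apply: is_deriveB; first by apply: is_derive1_onem_powR; lra.
    by apply: is_derive1_powR; lra.
  - move=> u v cu uv vt; rewrite !divr1.
    have := @powR_convex_gap R (r - 1) u v.
    have -> : r - 1 <= 0 by lra.
    have -> : 0 < u by lra.
    have -> : v <= 1 - v by lra.
    move=> /(_ isT isT uv isT).
    nra.
rewrite ler_pdivrMr; last by lra.
rewrite mulrAC ler_pdivlMr; last by lra.
move=> H; rewrite ler_pdivrMr; last by lra.
by rewrite mulrAC ler_pdivlMr; nra.
Qed.

Definition qubit_trpow (R : realType) (w l : R) : R :=
  l `^ w + (1 - l) `^ w - 1.

Lemma is_derive_qubit_trpow (R : realType) (w u : R) : 0 < u < 1 ->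
  is_derive u 1 (qubit_trpow w) (w * (u `^ (w - 1) - (1 - u) `^ (w - 1))).
Proof.
move=> u01; rewrite mulrBr.
have d1 : is_derive u 1 (fun v : R => v `^ w) (w * u `^ (w - 1)).
  by apply: is_derive1_powR; lra.
have d2 := @is_derive1_onem_powR R w u.
have {}d2 := d2 ltac:(lra).
rewrite /qubit_trpow -[X in is_derive _ _ _ X]subr0.
by apply: is_deriveB; exact: is_deriveD.
Qed.

Lemma continuous_qubit_trpow (R : realType) (w t : R) : 0 < w -> 0 < t -> t < 1 ->
  {within `[0, t], continuous (qubit_trpow w)}.
Proof.
move=> w0 t0 t1.
have c1 (u : R) : 0 < u < 1 -> qubit_trpow w @ u --> qubit_trpow w u.
  move=> u01.
  exact: is_derive1_continuous (is_derive_qubit_trpow w u01).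
apply/continuous_within_itvP => //; split.
- by move=> u; rewrite in_itv /= => ?; apply: c1; lra.
(* At 0 the power l^w need not be differentiable, so its right limit is taken directly. *)
- rewrite /qubit_trpow powR0 ?gt_eqF//.
  apply: cvgB; last exact: cvg_cst.
  apply: cvgD; first exact: powR_cvg0.
  apply: cvg_at_right_filter.
  have d0 : is_derive (0 : R) 1 (fun v : R => (1 - v) `^ w)
      (- (w * (1 - 0) `^ (w - 1))).
    exact: is_derive1_onem_powR.
  exact: is_derive1_continuous d0.
- by apply: cvg_at_left_filter; apply: c1; lra.
Qed.

Lemma qubit_trpow0 (R : realType) (w : R) : 0 < w -> qubit_trpow w 0 = 0.
Proof.
by move=> w0; rewrite /qubit_trpow powR0 ?gt_eqF// subr0 powR1 add0r subrr.
Qed.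

(** Concavity in the determinant: these are slopes of chords from the origin of [qubit_trpow]
    plotted against l (1 - l). The ratio of derivatives is monotone by [powR_diff_ratio_nincr] with
    exponent w - 1. *)
Lemma qubit_trpow_ratio_nincr (R : realType) (w l m : R) : 0 < w -> w <= 1 ->
    0 < l -> l < m -> m <= 1 / 2 ->
  qubit_trpow w m / (m * (1 - m)) <= qubit_trpow w l / (l * (1 - l)).
Proof.
move=> w0 w1 l0 lm m2.
have dg (u : R) : is_derive u 1 (fun u : R => u * (1 - u)) (1 - 2 * u).
  by apply: is_derive_eq; rewrite /GRing.scale /=; ring.
have := @slope_nincr R (qubit_trpow w)
  (fun u => w * (u `^ (w - 1) - (1 - u) `^ (w - 1)))
  (fun u => u * (1 - u)) (fun u => 1 - 2 * u) 0 l l m.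
rewrite qubit_trpow0// mul0r !subr0.
set kl := qubit_trpow w l; set km := qubit_trpow w m.
move=> H.
have {H} : (km - kl) / (m * (1 - m) - l * (1 - l)) <= kl / (l * (1 - l)).
  apply: H => //.
  - by apply: continuous_qubit_trpow => //; lra.
  - by apply: continuous_subspaceT => u; exact: is_derive1_continuous (dg u).
  - by move=> u; rewrite in_itv /= => ?; apply: is_derive_qubit_trpow; lra.
  - by move=> u; rewrite in_itv /= => ?; rewrite gt_eqF//; lra.
  - move=> u v u0 uv vm; rewrite -!mulrA; apply: ler_wpM2l; first by lra.
    by apply: powR_diff_ratio_nincr; lra.
have pl : 0 < l * (1 - l) by nra.
have pm : 0 < m * (1 - m) - l * (1 - l) by nra.
rewrite ler_pdivrMr // mulrAC ler_pdivlMr // => H.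
rewrite ler_pdivrMr; last by lra.
by rewrite mulrAC ler_pdivlMr //; nra.
Qed.

Lemma qubit_trpow_ndecr (R : realType) (w l m : R) : 0 < w -> w <= 1 ->
  0 <= l -> l <= m -> m <= 1 / 2 -> qubit_trpow w l <= qubit_trpow w m.
Proof.
move=> w0 w1 l0 lm m2.
have [->//|lm'] := eqVneq l m.
have {lm'}lm' : l < m by rewrite lt_neqAle lm' lm.
rewrite -subr_ge0.
have [||c + ->] := @MVT R (qubit_trpow w)
   (fun u => w * (u `^ (w - 1) - (1 - u) `^ (w - 1))) l m lm'.
- by move=> u; rewrite in_itv /= => ?; apply: is_derive_qubit_trpow; lra.
- apply: continuous_subspaceW (@continuous_qubit_trpow R w m w0 _ _).
  + by apply: subset_itvr; rewrite bnd_simp.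
  + by lra.
  + by lra.
rewrite in_itv /= => cI; apply: mulr_ge0; last by lra.
apply: mulr_ge0; first by lra.
by rewrite subr_ge0; apply: le0_powR_nincr; lra.
Qed.

(* For [1 < x] the square root is 0, so that [small_eig x] stays at 1/2: the   *)
(* inequalities on [tangle_G] below then hold on all of x >= 0.               *)
Definition small_eig (R : realType) (x : R) : R := (1 - Num.sqrt (1 - x)) / 2.

(** This is K: for 0 <= x <= 1, [small_eig x] is the smaller eigenvalue of a qubit state of
    determinant x / 4. *)
Definition tangle_G (R : realType) (w x : R) : R :=
  qubit_trpow w (small_eig x) `^ w.

Lemma small_eig_ge0 (R : realType) (x : R) : 0 <= x -> 0 <= small_eig x.
Proof.
move=> x0; rewrite /small_eig divr_ge0// subr_ge0.
by rewrite -[leRHS]sqrtr1 ler_wsqrtr//; lra.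
Qed.

Lemma small_eig_le (R : realType) (x : R) : small_eig x <= 1 / 2.
Proof. by have := sqrtr_ge0 (1 - x); rewrite /small_eig; lra. Qed.

Lemma small_eig_ndecr (R : realType) (x y : R) :
  x <= y -> small_eig x <= small_eig y.
Proof.
move=> xy; have : Num.sqrt (1 - y) <= Num.sqrt (1 - x).
  by apply: ler_wsqrtr; lra.
by rewrite /small_eig; lra.
Qed.

Lemma small_eigM (R : realType) (x : R) : 0 <= x -> x <= 1 ->
  small_eig x * (1 - small_eig x) = x / 4.
Proof.
move=> x0 x1; rewrite /small_eig; have := @sqr_sqrtr _ (1 - x).
rewrite subr_ge0 x1 => /(_ isT); set s := Num.sqrt _ => sE.
by nra.
Qed.

Lemma powR_subadditive (R : realType) (w a b : R) :
  0 < w -> w <= 1 -> 0 <= a -> 0 <= b -> (a + b) `^ w <= a `^ w + b `^ w.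
Proof.
move=> w0 w1 a0 b0; have [->|ab0] := eqVneq (a + b) 0.
  by rewrite powR0 ?gt_eqF// addr_ge0// powR_ge0.
have {ab0}ab : 0 < a + b by rewrite lt_neqAle eq_sym ab0 addr_ge0.
(* A fraction in [0, 1] is at most its w-th power, and those of a and b sum to 1. *)
have frac c : 0 <= c -> c <= a + b -> c / (a + b) * (a + b) `^ w <= c `^ w.
  move=> c0 cab; have [->|cn0] := eqVneq c 0.
    by rewrite mul0r mul0r powR_ge0.
  have {cn0}c0' : 0 < c by rewrite lt_neqAle eq_sym cn0.
  rewrite -[in leRHS](divfK (lt0r_neq0 ab) c) powRM ?divr_ge0 ?(ltW ab)//.
  rewrite ler_wpM2r ?powR_ge0// ger1_powR// divr_gt0//=.
  by rewrite ler_pdivrMr// mul1r.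
have /= := lerD (frac a a0 _) (frac b b0 _).
rewrite -mulrDl -mulrDl divff ?gt_eqF// mul1r; apply; by lra.
Qed.

Section TangleG.
Variables (R : realType) (w : R).
Hypotheses (w0 : 0 < w) (w1 : w <= 1).

Lemma qubit_trpow_ge0 (x : R) : 0 <= x -> 0 <= qubit_trpow w (small_eig x).
Proof.
move=> x0; rewrite -(qubit_trpow0 w0); apply: qubit_trpow_ndecr => //.
  exact: small_eig_ge0.
exact: small_eig_le.
Qed.

Lemma tangle_G_ndecr (x y : R) : 0 <= x -> x <= y -> tangle_G w x <= tangle_G w y.
Proof.
move=> x0 xy; have y0 := le_trans x0 xy.
apply: ge0_ler_powR; rewrite ?nnegrE ?(ltW w0) ?qubit_trpow_ge0//.
apply: qubit_trpow_ndecr => //; first exact: small_eig_ge0.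
  exact: small_eig_ndecr.
exact: small_eig_le.
Qed.

(** Up to 1 this is [qubit_trpow_ratio_nincr] at determinant x / 4; beyond 1 the numerator is
    constant and the denominator grows. *)
Lemma qubit_trpow_small_eig_ratio (x y : R) : 0 < x -> x <= y ->
  qubit_trpow w (small_eig y) / y <= qubit_trpow w (small_eig x) / x.
Proof.
move=> x0 xy.
have le1 (u v : R) : 0 < u -> u <= v -> v <= 1 ->
    qubit_trpow w (small_eig v) / v <= qubit_trpow w (small_eig u) / u.
  move=> u0; rewrite le_eqVlt => /predU1P[->//|uv] v1.
  have uE := @small_eigM R u; have vE := @small_eigM R v.
  have {}uE := uE ltac:(lra) ltac:(lra); have {}vE := vE ltac:(lra) ltac:(lra).
  have u0' : 0 < small_eig u.
    by have := @small_eig_ge0 R u (ltW u0); nra.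
  have uv' : small_eig u < small_eig v.
    have := @small_eig_ndecr R u v (ltW uv); rewrite le_eqVlt => /predU1P[e|//].
    by move: uE; rewrite e; lra.
  have := qubit_trpow_ratio_nincr w0 w1 u0' uv' (small_eig_le v).
  have e (k a : R) : k / (a / 4) = 4 * (k / a) by rewrite invf_div mulrCA.
  by rewrite uE vE (e _ u) (e _ v) (@ler_pM2l _ 4).
have cst (v : R) : 1 <= v -> small_eig v = small_eig 1.
  by move=> v1; rewrite /small_eig !ler0_sqrtr//; lra.
have [y1|y1] := leP y 1; first exact: le1.
have [x1|x1] := leP x 1; last first.
  rewrite !cst ?(ltW y1) ?(ltW x1)//.
  apply: ler_wpM2l; first by apply: qubit_trpow_ge0.
  by rewrite lef_pV2 ?posrE; lra.
apply: le_trans (le1 x 1 x0 x1 (lexx 1)).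
rewrite cst ?(ltW y1)//.
apply: ler_wpM2l; first by apply: qubit_trpow_ge0.
by rewrite lef_pV2 ?posrE; lra.
Qed.

Lemma tangle_G0 : tangle_G w 0 = 0.
Proof.
rewrite /tangle_G /small_eig subr0 sqrtr1 subrr mul0r.
by rewrite qubit_trpow0// powR0 ?gt_eqF.
Qed.

(** Since q(x) / x is nonincreasing, q(x) >= x q(x + y) / (x + y), and likewise for y; adding makes
    q subadditive, and the w-th power is monotone and subadditive. *)
Lemma tangle_GD (x y : R) : 0 <= x -> 0 <= y ->
  tangle_G w (x + y) <= tangle_G w x + tangle_G w y.
Proof.
rewrite le_eqVlt => /predU1P[<-|x0]; first by rewrite tangle_G0 !add0r.
rewrite le_eqVlt => /predU1P[<-|y0]; first by rewrite tangle_G0 !addr0.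
have xy0 : 0 < x + y by lra.
set q := fun u => qubit_trpow w (small_eig u).
have qx : q (x + y) / (x + y) * x <= q x.
  by rewrite -ler_pdivlMr//; apply: qubit_trpow_small_eig_ratio => //; lra.
have qy : q (x + y) / (x + y) * y <= q y.
  by rewrite -ler_pdivlMr//; apply: qubit_trpow_small_eig_ratio => //; lra.
have qxy : q (x + y) <= q x + q y.
  by have := lerD qx qy; rewrite -mulrDr divfK// gt_eqF.
have q0 u : 0 < u -> 0 <= q u by move=> u0; apply: qubit_trpow_ge0; exact: ltW.
apply: le_trans (powR_subadditive w0 w1 (q0 x x0) (q0 y y0)).
have qs : 0 <= q x + q y by rewrite addr_ge0 ?q0.
exact: (ge0_ler_powR (ltW w0) (q0 _ xy0) qs qxy).
Qed.

Lemma tangle_G_sum (I : Type) (r : seq I) (F : I -> R) :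
    (forall i, 0 <= F i) ->
  tangle_G w (\sum_(i <- r) F i) <= \sum_(i <- r) tangle_G w (F i).
Proof.
move=> F0; elim: r => [|i r IHr]; first by rewrite !big_nil tangle_G0.
rewrite !big_cons; apply: le_trans (tangle_GD _ _) _ => //.
  exact: sumr_ge0.
by rewrite lerD2l.
Qed.

End TangleG.

(** * Rotating ensembles of vectors *)

Definition nsq (R : realType) (z : R[i]) : R :=
  complex.Re z ^+ 2 + complex.Im z ^+ 2.

Lemma nsq_ge0 (R : realType) (z : R[i]) : 0 <= nsq z.
Proof. by rewrite addr_ge0 ?sqr_ge0. Qed.

Lemma nsq_eq0 (R : realType) (z : R[i]) : (nsq z == 0) = (z == 0).
Proof.
by case: z => a b; rewrite eq_complex paddr_eq0 ?sqr_ge0//= !sqrf_eq0.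
Qed.

Lemma nsqE (R : realType) (z : R[i]) : (nsq z)%:C = z * z^*%C.
Proof. by rewrite -sqr_normc -add_Re2_Im2. Qed.

Lemma nsqM (R : realType) (x y : R[i]) : nsq (x * y) = nsq x * nsq y.
Proof. by case: x => a b; case: y => c d; rewrite /nsq /=; ring. Qed.

Lemma nsqN (R : realType) (x : R[i]) : nsq (- x) = nsq x.
Proof. by case: x => a b; rewrite /nsq /= !sqrrN. Qed.

Lemma nsq_real (R : realType) (c : R) : nsq c%:C = c ^+ 2.
Proof. by rewrite /nsq /= expr0n addr0. Qed.

Definition vsq (R : realType) (n : nat) (v : 'cV[R[i]]_n) : R :=
  \sum_i nsq (v i 0).

Lemma vsq_ge0 (R : realType) (n : nat) (v : 'cV[R[i]]_n) : 0 <= vsq v.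
Proof. by apply: sumr_ge0 => i _; exact: nsq_ge0. Qed.

Lemma vsq_eq0 (R : realType) (n : nat) (v : 'cV[R[i]]_n) : vsq v = 0 -> v = 0.
Proof.
move=> /eqP; rewrite psumr_eq0 => [/allP v0|i _]; last exact: nsq_ge0.
apply/colP => i; rewrite mxE; apply/eqP; rewrite -nsq_eq0.
by have /= := v0 i; rewrite mem_index_enum => /(_ isT).
Qed.

Lemma vsqZ (R : realType) (n : nat) (c : R[i]) (v : 'cV[R[i]]_n) :
  vsq (c *: v) = nsq c * vsq v.
Proof. by rewrite /vsq mulr_sumr; apply: eq_bigr => i _; rewrite mxE nsqM. Qed.

Lemma ket_braE (R : realType) (n : nat) (v : 'cV[R[i]]_n) i j :
  ket_bra v i j = v i 0 * (v j 0)^*%C.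
Proof. by rewrite /ket_bra mxE big_ord1 !mxE. Qed.

Lemma ket_braZ (R : realType) (n : nat) (c : R[i]) (v : 'cV[R[i]]_n) :
  ket_bra (c *: v) = (nsq c)%:C *: ket_bra v.
Proof.
apply/matrixP => i j; rewrite [RHS]mxE !ket_braE !mxE nsqE rmorphM/=.
by rewrite !mulrA; congr (_ * _); rewrite -!mulrA; congr (_ * _); rewrite mulrC.
Qed.

Lemma mxtrace_ket_bra (R : realType) (n : nat) (v : 'cV[R[i]]_n) :
  \tr (ket_bra v) = (vsq v)%:C.
Proof.
rewrite /vsq rmorph_sum/=; apply: eq_bigr => i _.
by rewrite ket_braE nsqE.
Qed.

Lemma unit_vectorP (R : realType) (n : nat) (v : 'cV[R[i]]_n) :
  unit_vector v <-> vsq v = 1.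
Proof.
rewrite /unit_vector -[in X in X <-> _]trace_mx11 mxtrace_mulC.
rewrite -/(ket_bra v) mxtrace_ket_bra; split=> [|->//].
by move/complexI.
Qed.

Lemma mulmx_col_ket_bra (R : realType) (n m : nat) (P : 'M[R[i]]_(n, m)) :
  P *m P^t* = \sum_j ket_bra (col j P).
Proof.
apply/matrixP => i k; rewrite mxE summxE; apply: eq_bigr => j _.
by rewrite ket_braE !mxE.
Qed.

Lemma psd_factor (R : realType) (n : nat) (A : 'M[R[i]]_n) :
    A \is hermsymmx ->
    (forall x : 'rV[R[i]]_n, 0 <= (x *m A *m x^t*) 0 0) ->
  exists D : 'M[R[i]]_n, A = D *m D^t*.
Proof.
move=> /hermitian_normalmx/orthomx_spectralP.
have PU := spectral_unitarymx A.
set P := spectralmx A in PU *; set d := spectral_diag A.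
rewrite invmx_unitary// => AE A0.
have PPt : P *m P^t* = 1%:M by apply/unitarymxP.
(* The rows of [P] are left eigenvectors of [A]; testing positivity on them yields the
   eigenvalues. *)
have d0 i : 0 <= d 0 i.
  have := A0 (row i P); rewrite AE !mulmxA.
  have e : row i P *m P^t* = row i 1%:M by rewrite -row_mul PPt.
  rewrite e -mulmxA -mulmxA.
  have e2 : P *m (row i P)^t* = col i 1%:M.
    rewrite -PPt; apply/matrixP => a b; rewrite !mxE.
    by apply: eq_bigr => k _; rewrite !mxE.
  by rewrite e2 -row_mul mul1mx mul_diag_mx !mxE eqxx mulr1.
exists (P^t* *m diag_mx (map_mx sqrtC d)).
rewrite [in LHS]AE; apply/matrixP => i j; rewrite !mul_mx_diag !mxE.
apply: eq_bigr => k _; rewrite !mxE rmorphM/= conjCK.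
rewrite (geC0_conj (_ : 0 <= sqrtC (d 0 k))) ?sqrtC_ge0//.
by rewrite -[in LHS](sqrtCK (d 0 k)); ring.
Qed.

(** The quadratic form with diagonal a, b and off-diagonal c is indefinite, hence has an isotropic
    unit vector: (t, 1) normalized, with t a root of a t^2 + 2 c t + b. *)
Lemma rotate_to_zero (R : realType) (a b c : R) : 0 < a -> b < 0 ->
  exists x y, x ^+ 2 + y ^+ 2 = 1 /\
    x ^+ 2 * a + 2 * (x * y) * c + y ^+ 2 * b = 0.
Proof.
move=> a0 b0; set D := c ^+ 2 - a * b.
have D0 : 0 <= D by rewrite /D; nra.
pose t := (Num.sqrt D - c) / a.
have tE : a * t ^+ 2 + 2 * c * t + b = 0.
  have := sqr_sqrtr D0; rewrite /t; set s := Num.sqrt D => sE.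
  have an0 : a != 0 by rewrite gt_eqF.
  have -> : a * ((s - c) / a) ^+ 2 + 2 * c * ((s - c) / a) + b =
      (s ^+ 2 - (c ^+ 2 - a * b)) / a by field.
  by rewrite sE /D subrr mul0r.
have n0 : 0 < 1 + t ^+ 2 by rewrite ltr_pwDl// sqr_ge0.
have nE := sqr_sqrtr (ltW n0).
have N0 : Num.sqrt (1 + t ^+ 2) != 0 by rewrite gt_eqF// sqrtr_gt0.
set N := Num.sqrt _ in nE N0.
exists (t / N), (N^-1); split.
  by rewrite expr_div_n exprVn nE; field; rewrite gt_eqF.
rewrite expr_div_n exprVn.
have -> : t ^+ 2 / N ^+ 2 * a + 2 * (t / N / N) * c + (N ^+ 2)^-1 * b =
  (a * t ^+ 2 + 2 * c * t + b) / N ^+ 2 by field.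
by rewrite tE mul0r.
Qed.

Lemma rotate_mulJ (R : realType) (x y : R) (a b c d : R[i]) :
    x ^+ 2 + y ^+ 2 = 1 ->
  (x%:C * a + y%:C * c) * (x%:C * b + y%:C * d)^*%C +
  ((- y)%:C * a + x%:C * c) * ((- y)%:C * b + x%:C * d)^*%C =
  a * b^*%C + c * d^*%C.
Proof.
move=> xy1; case: a b c d => [a1 a2] [b1 b2] [c1 c2] [d1 d2].
apply/eqP; rewrite eq_complex /= !mul0r !subr0 !addr0; apply/andP; split.
  apply/eqP; transitivity ((x ^+ 2 + y ^+ 2) *
    (a1 * b1 + a2 * b2 + (c1 * d1 + c2 * d2))); first by ring.
  by rewrite xy1; ring.
apply/eqP; transitivity ((x ^+ 2 + y ^+ 2) *
  (a2 * b1 - a1 * b2 + (c2 * d1 - c1 * d2))); first by ring.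
by rewrite xy1; ring.
Qed.

Lemma ket_bra_rotate (R : realType) (n : nat) (x y : R) (u v : 'cV[R[i]]_n) :
    x ^+ 2 + y ^+ 2 = 1 ->
  ket_bra (x%:C *: u + y%:C *: v) + ket_bra ((- y)%:C *: u + x%:C *: v) =
  ket_bra u + ket_bra v.
Proof.
move=> xy1; apply/matrixP => i j.
have addE (A B : 'M[R[i]]_n) : (A + B) i j = A i j + B i j by rewrite mxE.
have E (a b : R[i]) k : (a *: u + b *: v) k 0 = a * u k 0 + b * v k 0.
  by rewrite mxE [X in X + _]mxE [X in _ + X]mxE.
have kE (a b : R[i]) : ket_bra (a *: u + b *: v) i j =
    (a * u i 0 + b * v i 0) * (a * u j 0 + b * v j 0)^*%C.
  by rewrite ket_braE !E.
apply: etrans (addE _ _) (etrans _ (esym (addE _ _))).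
apply: etrans (congr2 +%R (kE _ _) (kE _ _)) _.
apply: etrans (rotate_mulJ _ _ _ _ xy1) _.
by congr (_ + _); rewrite ket_braE.
Qed.

(* Two vectors on which [q] has opposite signs are rotated into one on which  *)
(* it vanishes and one carrying the sum; this keeps the sum of projectors.    *)
Lemma rotate_nonneg (R : realType) (n : nat) (q : 'cV[R[i]]_n -> R)
    (B : 'cV[R[i]]_n -> 'cV[R[i]]_n -> R) (s : seq 'cV[R[i]]_n) :
    (forall (x y : R) u v, q (x%:C *: u + y%:C *: v) =
       x ^+ 2 * q u + 2 * (x * y) * B u v + y ^+ 2 * q v) ->
    0 <= \sum_(v <- s) q v ->
  exists2 s', \sum_(v <- s') ket_bra v = \sum_(v <- s) ket_bra v
            & forall v, v \in s' -> 0 <= q v.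
Proof.
move=> qE.
have [m] := ubnP (size s); elim: m s => // m IHm s; rewrite ltnS => sz s0.
have [/allP all0|/allPn[v vs]] := boolP (all (fun v => 0 <= q v) s).
  by exists s.
rewrite -ltNge => qv.
(* As the total is nonnegative, a negative value forces a positive one. *)
have [/hasP[u us qu]|/hasPn nu] := boolP (has (fun u => 0 < q u) s); last first.
  exfalso; move: s0; rewrite (big_rem v)//= leNgt => /negP; apply.
  rewrite -[ltRHS]addr0 ltr_leD//; rewrite big_seq sumr_le0// => x /mem_rem xs.
  by rewrite leNgt nu.
have uv : u != v by apply: contraTneq qu => ->; rewrite -leNgt ltW.
have vs' : v \in rem u s.
  have := perm_to_rem us => /perm_mem/(_ v).
  by rewrite vs in_cons eq_sym (negbTE uv)/= => <-.
have ps : perm_eq s (u :: v :: rem v (rem u s)).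
  by apply: (perm_trans (perm_to_rem us)); rewrite perm_cons perm_to_rem.
set r := rem v (rem u s) in ps.
have [x [y [xy1 q0]]] := rotate_to_zero (B u v) qu qv.
have [u' [v' [qu' quv kuv]]] : exists u' v', [/\ q u' = 0,
    q u' + q v' = q u + q v & ket_bra u' + ket_bra v' = ket_bra u + ket_bra v].
  exists (x%:C *: u + y%:C *: v), ((- y)%:C *: u + x%:C *: v); split.
  - by rewrite qE.
  - transitivity ((x ^+ 2 + y ^+ 2) * (q u + q v)); last by rewrite xy1 mul1r.
    by rewrite !qE; ring.
  - exact: ket_bra_rotate.
(* [u'] is settled, with [q u' = 0]; the remaining list is one shorter and has the same total. *)
have [||s' s'E s'0] := IHm (v' :: r).
- by move: sz; rewrite (perm_size ps).
- by move: s0; rewrite (perm_big _ ps)/= !big_cons addrA -quv qu' add0r.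
exists (u' :: s') => [|z].
  by rewrite big_cons s'E (perm_big _ ps)/= !big_cons !addrA kuv.
by rewrite in_cons => /predU1P[->|/s'0//]; rewrite qu'.
Qed.

Lemma nsq_conj (R : realType) (z : R[i]) : nsq z^*%C = nsq z.
Proof. by case: z => a b; rewrite /nsq /= sqrrN. Qed.

Lemma nsq_sum (R : realType) (I : finType) (z : I -> R[i]) :
  nsq (\sum_i z i) = \sum_i \sum_j complex.Re (z i * (z j)^*%C).
Proof.
rewrite /nsq !raddf_sum/= !expr2 !mulr_suml -big_split/=.
apply: eq_bigr => i _; rewrite !mulr_sumr -big_split/=.
by apply: eq_bigr => j _; case: (z i) (z j) => a b [c d] /=; ring.
Qed.

Lemma lagrange_identity (R : realType) (I : finType) (a b : I -> R[i]) :
  \sum_i \sum_j nsq (a i * b j - a j * b i) =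
  2 * ((\sum_i nsq (a i)) * (\sum_i nsq (b i)) -
       nsq (\sum_i a i * (b i)^*%C)).
Proof.
have E i j : nsq (a i * b j - a j * b i) =
    nsq (a i) * nsq (b j) + nsq (b i) * nsq (a j) -
    2 * complex.Re ((a i * (b i)^*%C) * (a j * (b j)^*%C)^*%C).
  by case: (a i) (b i) (a j) (b j) => ? ? [? ?] [? ?] [? ?]; rewrite /nsq /=; ring.
under eq_bigr do under eq_bigr do rewrite E.
under eq_bigr do rewrite sumrB big_split/= -!mulr_sumr.
rewrite sumrB big_split/= -!mulr_suml -mulr_sumr -nsq_sum.
by ring.
Qed.

Lemma cauchy_schwarz_nsq (R : realType) (I : finType) (a b : I -> R[i]) :
  nsq (\sum_i a i * b i) <= (\sum_i nsq (a i)) * (\sum_i nsq (b i)).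
Proof.
have := lagrange_identity a (fun i => (b i)^*%C).
have -> : \sum_i a i * ((b i)^*%C)^*%C = \sum_i a i * b i.
  by apply: eq_bigr => i _; rewrite conjcK.
have -> : \sum_i nsq ((b i)^*%C) = \sum_i nsq (b i).
  by apply: eq_bigr => i _; rewrite nsq_conj.
move=> L; rewrite -subr_ge0 -(@pmulr_rge0 _ 2)// -L.
by apply: sumr_ge0 => i _; apply: sumr_ge0 => j _; exact: nsq_ge0.
Qed.

Lemma mulmx_tC00 (R : realType) (n : nat) (x : 'rV[R[i]]_n) :
  (x *m x^t*) 0 0 = (\sum_i nsq (x 0 i))%:C.
Proof.
by rewrite mxE rmorph_sum/=; apply: eq_bigr => i _; rewrite !mxE nsqE.
Qed.

(** The Hilbert-Schmidt norm bounds the operator norm, so V is a contraction and [psd_factor]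
    applies to 1 - V V^t*. *)
Lemma onem_contraction_factor (R : realType) (m : nat) (V : 'M[R[i]]_m) :
    \sum_i \sum_j nsq (V i j) = 1 ->
  exists D : 'M[R[i]]_m, V *m V^t* + D *m D^t* = 1%:M.
Proof.
move=> V1; have [||D DE] := @psd_factor R m (1%:M - V *m V^t*).
- apply/is_hermitianmxP; rewrite expr0 scale1r linearB/= rmorphB/=.
  by rewrite trmx1 map_mx1 trmx_mul map_mxM/= trmxCK.
- move=> x; rewrite mulmxBr mulmx1 mulmxBl.
  have -> : x *m (V *m V^t*) *m x^t* = (x *m V) *m (x *m V)^t*.
    by rewrite trmx_mul map_mxM !mulmxA.
  have subE (A B : 'M[R[i]]_1) : (A - B) 0 0 = A 0 0 - B 0 0.
    by rewrite mxE [X in _ + X]mxE.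
  rewrite subE !mulmx_tC00 -rmorphB/= ler0c subr_ge0.
  apply: le_trans (_ : \sum_j (\sum_i nsq (x 0 i)) * (\sum_i nsq (V i j)) <= _).
    by apply: ler_sum => j _; rewrite mxE; exact: cauchy_schwarz_nsq.
  by rewrite -mulr_sumr exchange_big/= V1 mulr1.
by exists D; rewrite -DE addrC subrK.
Qed.

Lemma mulmx_tCZ (R : realType) (n m : nat) (c : R[i]) (A : 'M[R[i]]_(n, m)) :
  (c *: A) *m (c *: A)^t* = (nsq c)%:C *: (A *m A^t*).
Proof.
have -> : (c *: A)^t* = c^*%C *: A^t*.
  by apply/matrixP => i j; rewrite !mxE rmorphM.
by rewrite -scalemxAl -scalemxAr scalerA nsqE.
Qed.

Lemma mxtrace_formZ (R : realType) (n m : nat) (c : R[i]) (Y : 'M[R[i]]_n)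
    (A : 'M[R[i]]_(n, m)) :
  \tr ((c *: A)^T *m Y *m (c *: A)) = (c * c) * \tr (A^T *m Y *m A).
Proof.
have -> : (c *: A)^T = c *: A^T by rewrite linearZ.
by rewrite -!scalemxAl -scalemxAr scalerA mxtraceZ.
Qed.

Lemma polar_mulmx_tC (R : realType) (n m : nat) (P Q : 'M[R[i]]_(n, m)) :
  (P + Q) *m (P + Q)^t* + (P - Q) *m (P - Q)^t* = (P *m P^t* + Q *m Q^t*) *+ 2.
Proof.
apply/matrixP => i j; rewrite mulr2n !mxE -!big_split/=; apply: eq_bigr => l _.
by rewrite !mxE rmorphD rmorphB/=; ring.
Qed.

Lemma polar_form (R : realType) (n m : nat) (Y : 'M[R[i]]_n)
    (P Q : 'M[R[i]]_(n, m)) : Y^T = Y ->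
  \tr ((P + Q)^T *m Y *m (P + Q)) - \tr ((P - Q)^T *m Y *m (P - Q)) =
  4%:R * \tr (P^T *m Y *m Q).
Proof.
move=> YT.
have [f fE] : exists f, forall A B : 'M[R[i]]_(n, m), \tr (A^T *m Y *m B) = f A B.
  by exists (fun A B => \tr (A^T *m Y *m B)).
have fC A B : f A B = f B A.
  by rewrite -!fE -mxtrace_tr !trmx_mul trmxK YT mulmxA.
have fD A B C : f (A + B) C = f A C + f B C.
  by rewrite -!fE !linearD/= !mulmxDl mxtraceD.
have fN A C : f (- A) C = - f A C.
  by rewrite -!fE !linearN/= !mulNmx raddfN.
rewrite !fE !fD !fN !(fC _ (_ + _)) !fD !fN (fC Q P).
by move: (f P P) (f P Q) (f Q Q) => a b c; ring.
Qed.

Definition colseq (R : realType) (n m : nat) (A : 'M[R[i]]_(n, m)) :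
  seq 'cV[R[i]]_n := [seq col j A | j <- enum 'I_m].

Lemma sum_ket_bra_colseq (R : realType) (n m : nat) (A : 'M[R[i]]_(n, m)) :
  \sum_(v <- colseq A) ket_bra v = A *m A^t*.
Proof. by rewrite big_map big_enum mulmx_col_ket_bra. Qed.

Lemma sum_form_colseq (R : realType) (n m : nat) (Y : 'M[R[i]]_n)
    (A : 'M[R[i]]_(n, m)) :
  \sum_(v <- colseq A) (v^T *m Y *m v) 0 0 = \tr (A^T *m Y *m A).
Proof.
rewrite big_map big_enum; apply: eq_bigr => j _.
rewrite !mxE; apply: eq_bigr => k _; rewrite !mxE; congr (_ * _).
by apply: eq_bigr => l _; rewrite !mxE.
Qed.

(* With [V := T^t* / |T|], a contraction, complete [Phi *m V] by [Phi *m D] to *)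
(* another ensemble of the same state; as T is symmetric, averaging it with   *)
(* [Phi] by polarization turns the diagonal sum into [\tr (T *m V) = |T|].    *)
Lemma ket_bra_form_decomposition (R : realType) (n m : nat)
    (Phi : 'M[R[i]]_(n, m)) (Y : 'M[R[i]]_n) : Y^T = Y ->
  exists2 s : seq 'cV[R[i]]_n, \sum_(v <- s) ket_bra v = Phi *m Phi^t*
    & \sum_(v <- s) complex.Re ((v^T *m Y *m v) 0 0) =
      Num.sqrt (\sum_i \sum_j nsq ((Phi^T *m Y *m Phi) i j)).
Proof.
move=> YT; set T := Phi^T *m Y *m Phi.
have TT : T^T = T by rewrite /T !trmx_mul trmxK YT mulmxA.
have [F0|F0] := eqVneq (\sum_i \sum_j nsq (T i j)) 0.
  exists (colseq Phi); first exact: sum_ket_bra_colseq.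
  rewrite -raddf_sum/= sum_form_colseq -/T F0 sqrtr0.
  suff -> : T = 0 by rewrite mxtrace0.
  move/eqP : F0; rewrite psumr_eq0 => [/allP F0|]; last first.
    by move=> i _; apply: sumr_ge0 => j _; exact: nsq_ge0.
  apply/matrixP => i j; rewrite [RHS]mxE; apply/eqP; rewrite -nsq_eq0.
  have /= := F0 i; rewrite mem_index_enum psumr_eq0 => [/(_ isT) /allP/(_ j)|].
    by rewrite mem_index_enum; exact.
  by move=> k _; exact: nsq_ge0.
set F2 := \sum_i _ in F0 *.
have F2ge0 : 0 <= F2.
  by apply: sumr_ge0 => i _; apply: sumr_ge0 => j _; exact: nsq_ge0.
set F := Num.sqrt F2.
have FF : F ^+ 2 = F2 by exact: sqr_sqrtr.
have Fn0 : F != 0 by rewrite -sqrf_eq0 FF.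
pose V := (F^-1)%:C *: T^t*.
have V1 : \sum_i \sum_j nsq (V i j) = 1.
  have -> : \sum_i \sum_j nsq (V i j) = \sum_i \sum_j (F^-1 ^+ 2 * nsq (T j i)).
    apply: eq_bigr => i _; apply: eq_bigr => j _.
    by rewrite [V i j]mxE nsqM nsq_real [in LHS]mxE nsq_conj [in LHS]mxE.
  under eq_bigr do rewrite -mulr_sumr.
  by rewrite -mulr_sumr exchange_big/= -/F2 -FF exprVn mulVf// sqrf_eq0.
have [D VD] := onem_contraction_factor V1.
(* The factors 1/2 and i/2 both weight projectors by 1/4, but the bilinear form by 1/4 and -1/4: the
   phase gives the minus sign of polarization and cancels the contribution of [W]. *)
pose h : R[i] := (2^-1)%:C; pose k : R[i] := h * 'i.
have hE : nsq h = 4^-1 by rewrite nsq_real; field.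
have kE : nsq k = 4^-1 by rewrite nsqM hE /nsq /= expr0n expr1n add0r mulr1.
have h2 : h * h = (4^-1)%:C by rewrite -rmorphM/=; congr (_%:C); field.
have k2 : k * k = - (4^-1)%:C.
  by rewrite /k mulrACA h2 -expr2 sqr_i mulrN1.
clearbody k h.
have q4 : (4^-1)%:C * 4%:R = 1 :> R[i].
  by rewrite -(rmorph_nat (real_complex R)) -rmorphM/= mulVf.
set Q := Phi *m V; set W := Phi *m D.
have QW : Q *m Q^t* + W *m W^t* = Phi *m Phi^t*.
  have assoc (M : 'M[R[i]]_m) :
      (Phi *m M) *m (Phi *m M)^t* = Phi *m (M *m M^t*) *m Phi^t*.
    by rewrite trmx_mul map_mxM !mulmxA.
  by rewrite !assoc -mulmxDl -mulmxDr VD mulmx1.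
have QE : Q = Phi *m V by [].
clearbody Q W.
have kb c (A : 'M[R[i]]_(n, m)) : nsq c = 4^-1 ->
    \sum_(v <- colseq (c *: A)) ket_bra v = (4^-1)%:C *: (A *m A^t*).
  by move=> cE; rewrite sum_ket_bra_colseq mulmx_tCZ cE.
have tr c (A : 'M[R[i]]_(n, m)) :
    \sum_(v <- colseq (c *: A)) complex.Re ((v^T *m Y *m v) 0 0) =
    complex.Re (c * c * \tr (A^T *m Y *m A)).
  by rewrite -raddf_sum sum_form_colseq mxtrace_formZ.
exists (colseq (h *: (Phi + Q)) ++ colseq (k *: (Phi - Q)) ++
        colseq (h *: W) ++ colseq (k *: W)).
  rewrite !big_cat/= (kb h _ hE) (kb k _ kE) (kb h _ hE) (kb k _ kE).
  rewrite -!scalerDr addrA polar_mulmx_tC -mulr2n -mulrnDl -addrA QW.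
  rewrite -mulr2n -mulrnA -(scaler_nat (2 * 2) (Phi *m Phi^t*)).
  by rewrite scalerA q4 scale1r.
rewrite !big_cat/= (tr h) (tr k) (tr h) (tr k) h2 k2.
rewrite -!raddfD !mulNr subrr addr0 -mulrBr polar_form// mulrA q4 mul1r.
have -> : Phi^T *m Y *m Q = T *m V by rewrite QE mulmxA.
have -> : T *m V = (F^-1)%:C *: (T *m T^t*) by rewrite -scalemxAr.
rewrite mxtraceZ.
have -> : \tr (T *m T^t*) = F2%:C.
  rewrite /F2 rmorph_sum/=; apply: eq_bigr => i _.
  rewrite mxE rmorph_sum/=; apply: eq_bigr => j _.
  by rewrite nsqE; congr (_ * _); rewrite mxE [in LHS]mxE.
by rewrite -rmorphM/= -FF expr2 mulKf.
Qed.

(** * Qubit-qudit pure states *)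

(** The 2 x 2 minors of the 2 x m amplitude matrix of [phi]. *)
Definition wedge (R : realType) (m : nat) (phi : 'cV[R[i]]_(2 * m)) (y y' : 'I_m) :
    R[i] :=
  phi (mxtens_index (0, y)) 0 * phi (mxtens_index (1, y')) 0 -
  phi (mxtens_index (0, y')) 0 * phi (mxtens_index (1, y)) 0.

Definition tangle (R : realType) (m : nat) (phi : 'cV[R[i]]_(2 * m)) : R :=
  2 * \sum_y \sum_y' nsq (wedge phi y y').

Lemma tangle_ge0 (R : realType) (m : nat) (phi : 'cV[R[i]]_(2 * m)) :
  0 <= tangle phi.
Proof.
rewrite mulr_ge0//; apply: sumr_ge0 => y _; apply: sumr_ge0 => y' _.
exact: nsq_ge0.
Qed.

Lemma tangleZ (R : realType) (m : nat) (c : R[i]) (phi : 'cV[R[i]]_(2 * m)) :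
  tangle (c *: phi) = nsq c ^+ 2 * tangle phi.
Proof.
rewrite /tangle mulrCA; congr (_ * _); rewrite mulr_sumr; apply: eq_bigr => y _.
rewrite mulr_sumr; apply: eq_bigr => y' _.
by rewrite /wedge !mxE expr2 -nsqM -nsqM; congr nsq; ring.
Qed.

Lemma sum_mxtens_index (V : nmodType) (m n : nat) (F : 'I_(m * n) -> V) :
  \sum_k F k = \sum_x \sum_y F (mxtens_index (x, y)).
Proof.
rewrite pair_big/= (reindex (@mxtens_index m n))/=.
  by apply: eq_bigr => -[x y].
by exists (@mxtens_unindex m n) => k _; [exact: mxtens_indexK|exact: mxtens_unindexK].
Qed.

Lemma ptraceY_ket_braE (R : realType) (m n : nat) (phi : 'cV[R[i]]_(m * n)) x x' :
  ptraceY (ket_bra phi) x x' =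
  \sum_y phi (mxtens_index (x, y)) 0 * (phi (mxtens_index (x', y)) 0)^*%C.
Proof. by rewrite mxE; apply: eq_bigr => y _; rewrite ket_braE. Qed.

Lemma ptraceY_ket_bra_herm (R : realType) (m n : nat) (phi : 'cV[R[i]]_(m * n)) :
  ptraceY (ket_bra phi) \is hermsymmx.
Proof.
apply/is_hermitianmxP; rewrite expr0 scale1r; apply/matrixP => x x'.
rewrite [RHS]mxE [in RHS]mxE !ptraceY_ket_braE rmorph_sum/=.
apply: eq_bigr => y _; rewrite rmorphM/= mulrC; congr (_ * _).
exact: (esym (conjcK _)).
Qed.

Lemma mxtrace_ptraceY_ket_bra (R : realType) (m n : nat) (phi : 'cV[R[i]]_(m * n)) :
  \tr (ptraceY (ket_bra phi)) = (vsq phi)%:C.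
Proof.
rewrite /vsq sum_mxtens_index rmorph_sum/=; apply: eq_bigr => x _.
rewrite ptraceY_ket_braE rmorph_sum/=; apply: eq_bigr => y _.
by rewrite nsqE.
Qed.

Lemma det_mx22 (R : comNzRingType) (A : 'M[R]_2) :
  \det A = A 0 0 * A 1 1 - A 0 1 * A 1 0.
Proof.
rewrite (expand_det_row _ 0) big_ord_recl big_ord1 /cofactor !det_mx11 !mxE.
rewrite expr0 expr1 mul1r mulN1r mulrN.
by congr (_ * A _ _ - A _ _ * A _ _); exact: val_inj.
Qed.

(** The reduced state is the Gram matrix of the two rows of amplitudes; Lagrange's identity
    expresses its determinant by minors, each counted twice over ordered pairs. *)
Lemma det_ptraceY_ket_bra (R : realType) (m : nat) (phi : 'cV[R[i]]_(2 * m)) :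
  \det (ptraceY (ket_bra phi)) = (tangle phi / 4)%:C.
Proof.
rewrite det_mx22 !ptraceY_ket_braE /tangle.
have -> : \sum_y \sum_y' nsq (wedge phi y y') = _ :=
  lagrange_identity (fun y => phi (mxtens_index (0, y)) 0)
                    (fun y => phi (mxtens_index (1, y)) 0).
set a := \sum_i nsq _; set b := \sum_i nsq _.
set c := \sum_i phi (mxtens_index (0, i)) 0 * (phi (mxtens_index (1, i)) 0)^*%C.
have -> : \sum_y phi (mxtens_index (0, y)) 0 * (phi (mxtens_index (0, y)) 0)^*%C = a%:C.
  by rewrite /a rmorph_sum/=; apply: eq_bigr => y _; rewrite nsqE.
have -> : \sum_y phi (mxtens_index (1, y)) 0 * (phi (mxtens_index (1, y)) 0)^*%C = b%:C.
  by rewrite /b rmorph_sum/=; apply: eq_bigr => y _; rewrite nsqE.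
have -> : \sum_y phi (mxtens_index (1, y)) 0 * (phi (mxtens_index (0, y)) 0)^*%C = c^*%C.
  rewrite /c rmorph_sum/=; apply: eq_bigr => y _.
  by rewrite rmorphM/= conjcK mulrC.
rewrite -nsqE -rmorphM -rmorphB/=; congr (_%:C).
by field.
Qed.

Lemma mxtrace_mxpowR (R : realType) (n : nat) (A : 'M[R[i]]_n) (w : R) :
  complex.Re (\tr (mxpowR A w)) = \sum_i complex.Re (spectral_diag A 0 i) `^ w.
Proof.
rewrite /mxpowR mxtrace_mulC mulKVmx ?spectral_unit// mxtrace_diag raddf_sum/=.
by apply: eq_bigr => i _; rewrite mxE.
Qed.

Lemma qubit_spectrum (R : realType) (A : 'M[R[i]]_2) (t : R) :
    A \is hermsymmx -> \tr A = 1 -> \det A = (t / 4)%:C ->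
  exists l0 l1 : R, [/\ l0 + l1 = 1, l0 * l1 = t / 4 &
    forall w, complex.Re (\tr (mxpowR A w)) = l0 `^ w + l1 `^ w].
Proof.
move=> Ah trA detA.
exists (complex.Re (spectral_diag A 0 0)), (complex.Re (spectral_diag A 0 1)).
have real k : spectral_diag A 0 k = (complex.Re (spectral_diag A 0 k))%:C.
  have /mxOverP /(_ 0 k) := hermitian_spectral_diag_real Ah.
  by move=> /RRe_real ->.
have /hermitian_normalmx/orthomx_spectralP AE := Ah.
split.
- move: trA; rewrite {1}AE mxtrace_mulC mulKVmx ?spectral_unit// mxtrace_diag.
  have l1 : lift ord0 ord0 = 1 :> 'I_2 by exact: val_inj.
  by rewrite big_ord_recl big_ord1 l1 real (real 1) -rmorphD => /complexI.
- move: detA; rewrite {1}AE !detM detV mulrAC mulVr; last first.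
    by rewrite -unitmxE spectral_unit.
  rewrite mul1r det_diag.
  have l1 : lift ord0 ord0 = 1 :> 'I_2 by exact: val_inj.
  by rewrite big_ord_recl big_ord1 l1 real (real 1) -rmorphM => /complexI.
- move=> w; rewrite mxtrace_mxpowR big_ord_recl big_ord1.
  have l1 : lift ord0 ord0 = 1 :> 'I_2 by exact: val_inj.
  by rewrite l1.
Qed.

Lemma G_concurrence_tangle (R : realType) (w : R) (m : nat)
    (phi : 'cV[R[i]]_(2 * m)) : vsq phi = 1 ->
  tangle phi <= 1 /\ G_concurrence w phi = tangle_G w (tangle phi).
Proof.
move=> phi1; rewrite /G_concurrence.
have [|||l0 [l1 [sum1 prod1 ->]]] :=
  @qubit_spectrum R (ptraceY (ket_bra phi)) (tangle phi).
- exact: ptraceY_ket_bra_herm.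
- by rewrite mxtrace_ptraceY_ket_bra phi1.
- exact: det_ptraceY_ket_bra.
have t0 := tangle_ge0 phi.
have t1 : tangle phi <= 1.
  have : 0 <= (l0 - l1) ^+ 2 by exact: sqr_ge0.
  have l1E : l1 = 1 - l0 by lra.
  by move: prod1; rewrite l1E => prod1 sq0; nra.
split; first exact: t1.
rewrite /tangle_G /qubit_trpow.
suff -> : l0 `^ w + l1 `^ w =
    small_eig (tangle phi) `^ w + (1 - small_eig (tangle phi)) `^ w by [].
have := small_eigM t0 t1; set s := small_eig _; rewrite -prod1 => sE.
have l1E : l1 = 1 - l0 by lra.
(* Both pairs of eigenvalues have sum 1 and the same product, so they agree up to order. *)
have : (l0 - s) * (l0 - (1 - s)) = 0 by move: sE; rewrite l1E => sE; nra.
move/eqP; rewrite mulf_eq0 !subr_eq0 => /orP[] /eqP l0E; rewrite l1E l0E//.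
by rewrite subKr addrC.
Qed.

Lemma G_concurrence_assist_ub (R : realType) (w : R) (m : nat)
    (rho : 'M[R[i]]_(2 * m)) : 0 < w -> w <= 1 ->
  has_ubound [set s : R | exists (k : nat) (p : 'I_k -> R)
    (phi : 'I_k -> 'cV[R[i]]_(2 * m)),
    pure_decomposition rho p phi /\ s = \sum_i p i * G_concurrence w (phi i)].
Proof.
move=> w0 w1; exists (tangle_G w 1) => _ [k [p [phi [[p0 p1 phi1 _] ->]]]].
rewrite -[leRHS]mul1r -[X in _ <= X * _]p1 mulr_suml; apply: ler_sum => i _.
apply: ler_wpM2l; first exact: p0.
have /unit_vectorP/(G_concurrence_tangle w)[t1 ->] := phi1 i.
exact: (tangle_G_ndecr w0 w1 (tangle_ge0 (phi i)) t1).
Qed.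

(** Ensembles may thus be unnormalized, [vsq v] being the weight. As [tangle] is homogeneous of
    degree 4, the quotient is the tangle of the normalized vector. *)
Lemma ge_G_concurrence_assist (R : realType) (w : R) (m : nat) (y0 : 'I_m)
    (rho : 'M[R[i]]_(2 * m)) (s : seq 'cV[R[i]]_(2 * m)) : 0 < w -> w <= 1 ->
    \sum_(v <- s) ket_bra v = rho -> \sum_(v <- s) vsq v = 1 ->
  \sum_(v <- s) vsq v * tangle_G w (tangle v / vsq v ^+ 2)
    <= G_concurrence_assist w rho.
Proof.
move=> w0 w1 rhoE s1.
(* A unit vector replacing the zero vectors, which carry weight 0; [y0] makes the space nonzero. *)
pose e : 'cV[R[i]]_(2 * m) := delta_mx (mxtens_index (0, y0)) 0.
have e1 : vsq e = 1.
  rewrite /vsq (bigD1 (mxtens_index (0, y0)))//= big1 => [|i ine].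
    by rewrite mxE !eqxx /nsq /= expr1n expr0n !addr0.
  by rewrite mxE (negbTE ine) /nsq /= expr0n addr0.
pose nrm (v : 'cV[R[i]]_(2 * m)) :=
  if vsq v == 0 then e else ((Num.sqrt (vsq v))^-1)%:C *: v.
have sq (v : 'cV[R[i]]_(2 * m)) : vsq v != 0 -> nsq ((Num.sqrt (vsq v))^-1)%:C = (vsq v)^-1.
  by move=> v0; rewrite nsq_real exprVn sqr_sqrtr ?vsq_ge0.
have nrm1 v : vsq (nrm v) = 1.
  rewrite /nrm; case: eqP => [//|/eqP v0].
  by rewrite vsqZ sq// mulVf.
have nrmK v : (vsq v)%:C *: ket_bra (nrm v) = ket_bra v.
  rewrite /nrm; case: eqP => [v0|/eqP v0].
    by rewrite v0 scale0r (vsq_eq0 v0) /ket_bra mul0mx.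
  by rewrite ket_braZ sq// scalerA -rmorphM/= divff// scale1r.
have nrmG v : vsq v * G_concurrence w (nrm v) =
    vsq v * tangle_G w (tangle v / vsq v ^+ 2).
  have [v0|v0] := eqVneq (vsq v) 0; first by rewrite v0 !mul0r.
  have tE : tangle (nrm v) = tangle v / vsq v ^+ 2.
    rewrite /nrm (negbTE v0) tangleZ.
    by rewrite (sq v v0) exprVn mulrC.
  have [_ GE] := G_concurrence_tangle w (nrm1 v).
  by rewrite GE tE.
rewrite /G_concurrence_assist.
apply: ub_le_sup; first exact: G_concurrence_assist_ub.
exists (size s), (fun i => vsq (tnth (in_tuple s) i)),
  (fun i => nrm (tnth (in_tuple s) i)); split; first split.
- by move=> i; exact: vsq_ge0.
- by rewrite -[RHS]s1 [RHS]big_tnth.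
- by move=> i; apply/unit_vectorP.
- rewrite -rhoE big_tnth; apply: eq_bigr => i _; exact/esym/nrmK.
by rewrite big_tnth; apply: eq_bigr => i _; rewrite nrmG.
Qed.

(** * Decompositions of high tangle *)

(** The spin-flip bilinear form; the modulus of [bitform v v] is Wootters' concurrence of v. *)
Definition bitform (R : realType) (u v : 'cV[R[i]]_(2 * 2)) : R[i] :=
  u (mxtens_index (0, 0)) 0 * v (mxtens_index (1, 1)) 0 +
  u (mxtens_index (1, 1)) 0 * v (mxtens_index (0, 0)) 0 -
  (u (mxtens_index (0, 1)) 0 * v (mxtens_index (1, 0)) 0 +
   u (mxtens_index (1, 0)) 0 * v (mxtens_index (0, 1)) 0).

(* [sigma_y (x) sigma_y] up to sign.                                          *)
Definition spinflip (R : realType) : 'M[R[i]]_(2 * 2) :=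
  delta_mx (mxtens_index (0, 0)) (mxtens_index (1, 1)) +
  delta_mx (mxtens_index (1, 1)) (mxtens_index (0, 0)) -
  (delta_mx (mxtens_index (0, 1)) (mxtens_index (1, 0)) +
   delta_mx (mxtens_index (1, 0)) (mxtens_index (0, 1))).

Lemma spinflip_sym (R : realType) : (spinflip R)^T = spinflip R.
Proof.
rewrite /spinflip linearB/= !linearD/= !trmx_delta.
by congr (_ + _); rewrite addrC.
Qed.

Lemma delta_formE (R : realType) (n : nat) (u v : 'cV[R[i]]_n) k l :
  (u^T *m delta_mx k l *m v) 0 0 = u k 0 * v l 0.
Proof.
rewrite mxE (bigD1 l)//= big1 => [|j jl].
  rewrite addr0; congr (_ * _); rewrite mxE (bigD1 k)//= big1 => [|j jk].
    by rewrite !mxE !eqxx mulr1 addr0.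
  by rewrite [X in _ * X]mxE (negbTE jk) mulr0.
rewrite mxE big1 ?mul0r// => a _.
by rewrite [X in _ * X]mxE (negbTE jl) andbF mulr0.
Qed.

Lemma spinflipE (R : realType) (u v : 'cV[R[i]]_(2 * 2)) :
  (u^T *m spinflip R *m v) 0 0 = bitform u v.
Proof.
rewrite /spinflip mulmxBr mulmxBl !mulmxDr !mulmxDl.
have addE (A B : 'M[R[i]]_1) : (A + B) 0 0 = A 0 0 + B 0 0 by rewrite mxE.
have subE (A B : 'M[R[i]]_1) : (A - B) 0 0 = A 0 0 - B 0 0.
  by rewrite mxE [X in _ + X]mxE.
have h k l k' l' :
    (u^T *m delta_mx k l *m v + u^T *m delta_mx k' l' *m v) 0 0 =
    u k 0 * v l 0 + u k' 0 * v l' 0.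
  by rewrite addE (delta_formE u v k l) (delta_formE u v k' l').
exact: etrans (subE _ _) (congr2 (fun a b => a - b) (h _ _ _ _) (h _ _ _ _)).
Qed.

Lemma tangle_bitform (R : realType) (v : 'cV[R[i]]_(2 * 2)) :
  tangle v = nsq (bitform v v).
Proof.
rewrite /tangle !big_ord_recl !big_ord0 /wedge !addr0.
have -> : lift ord0 ord0 = 1 :> 'I_2 by exact: val_inj.
rewrite /bitform; set a := v (mxtens_index (0, 0)) 0.
set b := v (mxtens_index (1, 1)) 0; set c := v (mxtens_index (0, 1)) 0.
set d := v (mxtens_index (1, 0)) 0.
move: a b c d => [a1 a2] [b1 b2] [c1 c2] [d1 d2].
by rewrite /nsq /=; ring.
Qed.

Lemma vsq_comb (R : realType) (n : nat) (x y : R) (u v : 'cV[R[i]]_n) :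
  vsq (x%:C *: u + y%:C *: v) = x ^+ 2 * vsq u +
    2 * (x * y) * (\sum_i complex.Re (u i 0 * (v i 0)^*%C)) + y ^+ 2 * vsq v.
Proof.
rewrite /vsq !mulr_sumr -!big_split/=; apply: eq_bigr => i _; rewrite !mxE.
by case: (u i 0) (v i 0) => a b [c d]; rewrite /nsq /=; ring.
Qed.

Lemma bitform_comb (R : realType) (x y : R) (u v : 'cV[R[i]]_(2 * 2)) :
  complex.Re (bitform (x%:C *: u + y%:C *: v) (x%:C *: u + y%:C *: v)) =
  x ^+ 2 * complex.Re (bitform u u) + 2 * (x * y) * complex.Re (bitform u v) +
  y ^+ 2 * complex.Re (bitform v v).
Proof.
have E k : (x%:C *: u + y%:C *: v) k 0 = x%:C * u k 0 + y%:C * v k 0.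
  by rewrite !mxE.
rewrite /bitform !E.
move: (u (mxtens_index (0, 0)) 0) (u (mxtens_index (0, 1)) 0) => [a1 a2] [b1 b2].
move: (u (mxtens_index (1, 0)) 0) (u (mxtens_index (1, 1)) 0) => [c1 c2] [d1 d2].
move: (v (mxtens_index (0, 0)) 0) (v (mxtens_index (0, 1)) 0) => [e1 e2] [f1 f2].
move: (v (mxtens_index (1, 0)) 0) (v (mxtens_index (1, 1)) 0) => [g1 g2] [h1 h2].
by rewrite /=; ring.
Qed.

Lemma sum_vsq (R : realType) (n : nat) (s : seq 'cV[R[i]]_n) :
  \sum_(v <- s) vsq v = complex.Re (\tr (\sum_(v <- s) ket_bra v)).
Proof.
rewrite (raddf_sum (@mxtrace R[i] n)) raddf_sum/=; apply: eq_bigr => v _.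
by rewrite mxtrace_ket_bra.
Qed.

(** Let F be the square root of the double sum. In the ensemble of [ket_bra_form_decomposition] the
    values Re (bitform v v) - F |v|^2 sum to 0, so [rotate_nonneg] makes each nonnegative; squaring
    gives the bound. *)
Lemma high_tangle_decomposition (R : realType) (m : nat) (Phi : 'M[R[i]]_(2 * 2, m)) :
    \tr (Phi *m Phi^t*) = 1 ->
  exists2 s : seq 'cV[R[i]]_(2 * 2), \sum_(v <- s) ket_bra v = Phi *m Phi^t*
    & forall v, v \in s ->
      vsq v ^+ 2 * (\sum_i \sum_j nsq (bitform (col i Phi) (col j Phi)))
        <= tangle v.
Proof.
move=> trPhi; set F2 := \sum_i _.
have F20 : 0 <= F2.
  by apply: sumr_ge0 => i _; apply: sumr_ge0 => j _; exact: nsq_ge0.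
have [s sE sF] := ket_bra_form_decomposition Phi (spinflip_sym R).
have {}sF : \sum_(v <- s) complex.Re (bitform v v) = Num.sqrt F2.
  transitivity (\sum_(v <- s) complex.Re ((v^T *m spinflip R *m v) 0 0)).
    by apply: eq_bigr => v _; rewrite spinflipE.
  rewrite sF; congr Num.sqrt; apply: eq_bigr => i _; apply: eq_bigr => j _.
  congr nsq; rewrite -spinflipE.
  have -> : (col i Phi)^T *m spinflip R *m col j Phi =
      row i (Phi^T *m spinflip R) *m col j Phi by rewrite tr_col row_mul.
  have rc (A : 'M[R[i]]_(m, 2 * 2)) (B : 'M[R[i]]_(2 * 2, m)) :
      (row i A *m col j B) 0 0 = (A *m B) i j.
    by rewrite !mxE; apply: eq_bigr => k _; rewrite !mxE.
  by rewrite rc.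
have [] := @rotate_nonneg R _
  (fun v => complex.Re (bitform v v) - Num.sqrt F2 * vsq v)
  (fun u v => complex.Re (bitform u v) -
     Num.sqrt F2 * (\sum_i complex.Re (u i 0 * (v i 0)^*%C))) s.
- by move=> x y u v; rewrite bitform_comb vsq_comb; ring.
- by rewrite sumrB sF -mulr_sumr sum_vsq sE trPhi mulr1 subrr.
move=> s' s'E s'0; exists s'; first by rewrite s'E.
move=> v /s'0; rewrite subr_ge0 => le.
rewrite tangle_bitform -(sqr_sqrtr F20) -exprMn mulrC.
apply: le_trans (_ : complex.Re (bitform v v) ^+ 2 <= _).
  rewrite ler_sqr ?nnegrE// ?mulr_ge0 ?sqrtr_ge0 ?vsq_ge0//.
  by apply: le_trans le; rewrite mulr_ge0 ?sqrtr_ge0 ?vsq_ge0.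
by rewrite /nsq lerDl sqr_ge0.
Qed.

(** * A Poincare inequality for bit swaps *)

(** On each quadruple x, S x, T x, S (T x) the squared diagonals are bounded by the squared sides;
    summing over x counts every term twice. *)
Lemma sum_nsq_commuting_involutions (R : realType) (X : finType) (f : X -> R[i])
    (S T : X -> X) :
    involutive S -> involutive T -> (forall x, S (T x) = T (S x)) ->
  \sum_x nsq (f x - f (S (T x))) <=
  \sum_x nsq (f x - f (S x)) + \sum_x nsq (f x - f (T x)).
Proof.
move=> SS TT ST.
have rS (F : X -> R) : \sum_x F (S x) = \sum_x F x.
  by rewrite [RHS](reindex S)//; exists S => x _; exact: SS.
have rT (F : X -> R) : \sum_x F (T x) = \sum_x F x.
  by rewrite [RHS](reindex T)//; exists T => x _; exact: TT.
have parallelogram (a b c d : R[i]) : nsq (a - d) + nsq (b - c) <=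
    nsq (a - b) + nsq (c - d) + (nsq (a - c) + nsq (b - d)).
  rewrite -subr_ge0; apply: le_trans (nsq_ge0 (a - b - c + d)) _.
  by case: a b c d => ? ? [? ?] [? ?] [? ?]; rewrite le_eqVlt /nsq /=;
    apply/orP; left; apply/eqP; ring.
have sum_le (a b c d e g : X -> R) :
    (forall x, a x + b x <= c x + d x + (e x + g x)) ->
    \sum_x a x + \sum_x b x <=
    \sum_x c x + \sum_x d x + (\sum_x e x + \sum_x g x).
  by move=> le; rewrite -!big_split; apply: ler_sum => x _; exact: le.
have := sum_le _ _ _ _ _ _
  (fun x => parallelogram (f x) (f (S x)) (f (T x)) (f (S (T x)))).
have -> : \sum_x nsq (f (T x) - f (S (T x))) = \sum_x nsq (f x - f (S x)).
  exact: rT (fun x => nsq (f x - f (S x))).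
have -> : \sum_x nsq (f (S x) - f (T x)) = \sum_x nsq (f x - f (S (T x))).
  rewrite -[LHS]rS; apply: eq_bigr => x _.
  by rewrite SS ST.
have -> : \sum_x nsq (f (S x) - f (S (T x))) = \sum_x nsq (f x - f (T x)).
  rewrite -[RHS]rS; apply: eq_bigr => x _.
  by rewrite ST.
by lra.
Qed.

Section BitSwaps.
Variables (R : realType) (n : nat).
Implicit Types (b : {ffun 'I_n -> 'I_2}) (J : seq 'I_n).
Local Notation bits := {ffun 'I_n -> 'I_2}.

Definition mix_bits J b b' : bits := [ffun k => if k \in J then b' k else b k].

Definition swap_bits J (p : bits * bits) : bits * bits :=
  (mix_bits J p.1 p.2, mix_bits J p.2 p.1).

Lemma swap_bitsK J : involutive (swap_bits J).
Proof.
by move=> [b b']; congr (_, _); apply/ffunP => k; rewrite !ffunE/=; case: (k \in J).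
Qed.

Lemma swap_bitsC J J' p :
  swap_bits J (swap_bits J' p) = swap_bits J' (swap_bits J p).
Proof.
by case: p => b b'; congr (_, _); apply/ffunP => k; rewrite !ffunE/=;
  case: (k \in J); case: (k \in J').
Qed.

Lemma swap_bits_cons j J p : j \notin J ->
  swap_bits (j :: J) p = swap_bits [:: j] (swap_bits J p).
Proof.
move=> jJ; case: p => b b'; congr (_, _); apply/ffunP => k;
  rewrite !ffunE/= !inE; case: eqP => [->|//=]; by rewrite (negbTE jJ).
Qed.

Lemma sum_nsq_swap_bits (f : bits * bits -> R[i]) J : uniq J ->
  \sum_p nsq (f p - f (swap_bits J p)) <=
  \sum_(j <- J) \sum_p nsq (f p - f (swap_bits [:: j] p)).
Proof.
elim: J => [_|j J IHJ /= /andP[jJ uJ]].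
  rewrite big_nil big1// => -[b b'] _.
  have -> : swap_bits [::] (b, b') = (b, b').
    by congr (_, _); apply/ffunP => k; rewrite !ffunE.
  by rewrite subrr /nsq /= expr0n addr0.
rewrite big_cons; apply: le_trans (lerD (lexx _) (IHJ uJ)).
under eq_bigr do rewrite (swap_bits_cons _ jJ).
apply: sum_nsq_commuting_involutions; [exact: swap_bitsK|exact: swap_bitsK|].
exact: swap_bitsC.
Qed.

(** Swapping all bits exchanges b and b', which negates W: the difference is 2 W, whence the factor
    4. *)
Lemma sum_nsq_antisym (W : bits -> bits -> R[i]) :
    (forall b b', W b' b = - W b b') ->
  4 * \sum_b \sum_b' nsq (W b b') <=
  \sum_j \sum_b \sum_b' nsq (W b b' - W (set_bit b j (b' j)) (set_bit b' j (b j))).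
Proof.
move=> Wa; have := sum_nsq_swap_bits (fun p => W p.1 p.2) (enum_uniq 'I_n).
have -> : \sum_p nsq (W p.1 p.2 - W (swap_bits (enum 'I_n) p).1
      (swap_bits (enum 'I_n) p).2) =
   4 * \sum_b \sum_b' nsq (W b b').
  rewrite pair_big/= mulr_sumr; apply: eq_bigr => -[b b'] _ /=.
  have -> : mix_bits (enum 'I_n) b b' = b'.
    by apply/ffunP => k; rewrite ffunE mem_enum.
  have -> : mix_bits (enum 'I_n) b' b = b.
    by apply/ffunP => k; rewrite ffunE mem_enum.
  by rewrite (Wa b b') opprK; case: (W b b') => x y; rewrite /nsq /=; ring.
move=> /le_trans; apply; rewrite big_enum/=; apply: ler_sum => j _.
rewrite pair_big/= le_eqVlt; apply/orP; left; apply/eqP.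
apply: eq_bigr => -[b b'] _ /=; congr (nsq (_ - W _ _));
  by apply/ffunP => k; rewrite !ffunE inE; case: eqP => [->|].
Qed.

Lemma set_bitE b j c : set_bit b j c j = c.
Proof. by rewrite ffunE eqxx. Qed.

Lemma set_bit_set b j c c' : set_bit (set_bit b j c) j c' = set_bit b j c'.
Proof. by apply/ffunP => k; rewrite !ffunE; case: eqP. Qed.

Lemma set_bit_id b j : set_bit b j (b j) = b.
Proof. by apply/ffunP => k; rewrite !ffunE; case: eqP => // ->. Qed.

Lemma reindex_bit (V : nmodType) (F : bits -> V) j c :
  \sum_(b : bits | b j == c) F b = \sum_(b : bits | b j == 0) F (set_bit b j c).
Proof.
rewrite (reindex_onto (fun b : bits => set_bit b j c) (fun b => set_bit b j 0)).
  apply: eq_bigl => b; rewrite set_bitE eqxx/= set_bit_set.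
  apply/eqP/eqP => [<-|<-]; first by rewrite set_bitE.
  exact: set_bit_id.
by move=> b /eqP <-; rewrite set_bit_set set_bit_id.
Qed.

Lemma sum_bit (V : nmodType) (F : bits -> V) j :
  \sum_b F b = \sum_(b : bits | b j == 0) (F (set_bit b j 0) + F (set_bit b j 1)).
Proof.
rewrite (partition_big (fun b : bits => b j) predT)//= big_ord_recl big_ord1.
rewrite big_split/= -(reindex_bit F j 0) -(reindex_bit F j 1).
by have -> : lift ord0 ord0 = 1 :> 'I_2 by exact: val_inj.
Qed.

(** Swapping equal bits changes nothing, and the two cases of distinct bits contribute equally. *)
Lemma sum_nsq_bit_swap (W : bits -> bits -> R[i]) j :
  \sum_b \sum_b' nsq (W b b' - W (set_bit b j (b' j)) (set_bit b' j (b j))) =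
  2 * \sum_(b : bits | b j == 0) \sum_(b' : bits | b' j == 0)
    nsq (W (set_bit b j 0) (set_bit b' j 1) - W (set_bit b j 1) (set_bit b' j 0)).
Proof.
have D0 b b' c : nsq (W (set_bit b j c) (set_bit b' j c) -
    W (set_bit b j c) (set_bit b' j c)) = 0.
  by rewrite subrr /nsq /= expr0n addr0.
rewrite (sum_bit _ j) mulr_sumr; apply: eq_bigr => b _.
rewrite !(sum_bit _ j) -big_split/= mulr_sumr; apply: eq_bigr => b' _.
rewrite !set_bitE !set_bit_set !D0 add0r addr0 mulr_natl mulr2n; congr (_ + _).
by rewrite -nsqN opprB.
Qed.

End BitSwaps.

(** * Reduced states *)

Section Reduction.
Variables (R : realType) (n : nat).
Local Notation bits := {ffun 'I_n -> 'I_2}.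

(* The columns are the (unnormalized) states of [AB_j] conditioned on the     *)
(* basis states of the other qubits; the latter are encoded by the bit        *)
(* strings [b] with [b j = 0], the other columns being zero.                  *)
Definition AB_amplitudes (phi : 'cV[R[i]]_(2 * qdim n)) (j : 'I_n) :
    'M[R[i]]_(2 * 2, qdim n) :=
  \matrix_(k, e) if (enum_val e : bits) j == 0 then
    phi (AB_index (mxtens_unindex k).1
          (set_bit (enum_val e) j (mxtens_unindex k).2)) 0 else 0.

Lemma sum_enum_val (V : nmodType) (F : bits -> V) :
  \sum_(e < qdim n) F (enum_val e) = \sum_b F b.
Proof.
rewrite [RHS](reindex (fun e : 'I_(qdim n) => enum_val e : bits))//.
exact/onW_bij/enum_val_bij.
Qed.

Lemma reduced_AB_ket_bra (phi : 'cV[R[i]]_(2 * qdim n)) j :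
  reduced_AB (ket_bra phi) j = AB_amplitudes phi j *m (AB_amplitudes phi j)^t*.
Proof.
apply/matrixP => u v; rewrite mxE [RHS]mxE.
case Eu : (mxtens_unindex u) => [a c]; case Ev : (mxtens_unindex v) => [a' c'].
rewrite reindex_bit big_mkcond/= -sum_enum_val; apply: eq_bigr => e _.
rewrite ket_braE !mxE Eu Ev/=; case: eqP => _; last by rewrite mul0r.
by rewrite set_bit_set; move: Eu Ev => [<- <-] [<- <-].
Qed.

Lemma mxtrace_reduced_AB (phi : 'cV[R[i]]_(2 * qdim n)) j :
  \tr (reduced_AB (ket_bra phi) j) = (vsq phi)%:C.
Proof.
rewrite /mxtrace sum_mxtens_index /vsq [in RHS]sum_mxtens_index rmorph_sum/=.
apply: eq_bigr => a _; rewrite rmorph_sum/=.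
transitivity (\sum_(b : bits) (nsq (phi (AB_index a b) 0))%:C).
  rewrite [RHS](partition_big (fun b : bits => b j) predT)//=.
  apply: eq_bigr => c _; rewrite mxE mxtens_indexK.
  apply: eq_bigr => b /eqP <-.
  by rewrite set_bit_id ket_braE nsqE.
rewrite -sum_enum_val; apply: eq_bigr => e _.
by rewrite /AB_index enum_valK.
Qed.

Lemma tangle_le_sum_AB (phi : 'cV[R[i]]_(2 * qdim n)) :
  tangle phi <= \sum_j \sum_e \sum_e'
    nsq (bitform (col e (AB_amplitudes phi j)) (col e' (AB_amplitudes phi j))).
Proof.
pose W (b b' : bits) := wedge phi (enum_rank b) (enum_rank b').
have Wa b b' : W b' b = - W b b' by rewrite /W /wedge; ring.
have tW : tangle phi = 2 * \sum_b \sum_b' nsq (W b b').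
  rewrite /tangle -sum_enum_val; congr (_ * _); apply: eq_bigr => e _.
  rewrite -sum_enum_val; apply: eq_bigr => e' _.
  by rewrite /W !enum_valK.
have := sum_nsq_antisym Wa.
have -> : 4 * \sum_b \sum_b' nsq (W b b') = 2 * tangle phi.
  by rewrite tW mulrA; congr (_ * _); ring.
under eq_bigr do rewrite sum_nsq_bit_swap.
rewrite -mulr_sumr ler_pM2l// => /le_trans; apply.
rewrite le_eqVlt; apply/orP; left; apply/eqP; apply: eq_bigr => j _.
rewrite big_mkcond/= -sum_enum_val; apply: eq_bigr => e _.
have nsq0 : nsq (0 : R[i]) = 0 by apply/eqP; rewrite nsq_eq0.
case: ifP => ej; last first.
  rewrite big1// => e' _.
  by rewrite /bitform !mxE ej !mul0r !addr0 subr0 nsq0.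
rewrite big_mkcond/= -sum_enum_val; apply: eq_bigr => e' _.
case: ifP => ej'; last first.
  by rewrite /bitform !mxE ej' !mulr0 !addr0 subr0 nsq0.
(* The four products in the two minors are those of the spin-flip form on the conditional states. *)
rewrite /bitform !mxE ej ej' !mxtens_indexK/=; congr nsq.
by rewrite /W /wedge /AB_index; ring.
Qed.

Lemma reduced_AB_sum (I : finType) (p : I -> R[i])
    (rho : I -> 'M[R[i]]_(2 * qdim n)) j :
  reduced_AB (\sum_i p i *: rho i) j = \sum_i p i *: reduced_AB (rho i) j.
Proof.
apply/matrixP => u v; rewrite summxE mxE.
case Eu : (mxtens_unindex u) => [a c]; case Ev : (mxtens_unindex v) => [a' c'].
under eq_bigr do rewrite summxE.
rewrite exchange_big/=; apply: eq_bigr => i _.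
rewrite [RHS]mxE [in RHS]mxE Eu Ev mulr_sumr; apply: eq_bigr => b _.
by rewrite mxE.
Qed.

End Reduction.

(** * Merging decompositions and passing to the supremum *)

Lemma G_concurrence_assist_ge0 (R : realType) (w : R) (m n : nat)
    (rho : 'M[R[i]]_(m * n)) :
  0 <= G_concurrence_assist w rho.
Proof.
rewrite /G_concurrence_assist; set A := [set s : R | _].
have [hs|/sup_out ->//] := pselect (has_sup A).
have [[x Ax] ub] := hs; apply: le_trans (ub_le_sup ub Ax).
case: Ax => k [p [phi [[p0 _ _ _] ->]]].
by apply: sumr_ge0 => i _; rewrite mulr_ge0 ?p0 ?powR_ge0.
Qed.

(** Scale the i-th ensemble by sqrt (p i) and concatenate. Each normalized member of nonzero weight
    has tangle at least [X i], and [tangle_G] is monotone. *)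
Lemma mixture_le_assist (R : realType) (w : R) (k : nat) (p X : 'I_k -> R)
    (rho : 'I_k -> 'M[R[i]]_(2 * 2)) (s : 'I_k -> seq 'cV[R[i]]_(2 * 2)) :
    0 < w -> w <= 1 -> (forall i, 0 <= p i) -> \sum_i p i = 1 ->
    (forall i, 0 <= X i) ->
    (forall i, \sum_(v <- s i) ket_bra v = rho i) ->
    (forall i, \tr (rho i) = 1) ->
    (forall i v, v \in s i -> vsq v ^+ 2 * X i <= tangle v) ->
  \sum_i p i * tangle_G w (X i) <=
  G_concurrence_assist w (\sum_i (p i)%:C *: rho i).
Proof.
move=> w0 w1 p0 p1 X0 sE tr1 sX.
pose S := flatten [seq [seq (Num.sqrt (p i))%:C *: v | v <- s i] | i <- enum 'I_k].
have nsqp i : nsq (Num.sqrt (p i))%:C = p i by rewrite nsq_real sqr_sqrtr.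
have sumS (V : nmodType) (F : 'cV[R[i]]_(2 * 2) -> V) :
    \sum_(v <- S) F v = \sum_i \sum_(v <- s i) F ((Num.sqrt (p i))%:C *: v).
  by rewrite big_flatten big_map big_enum; apply: eq_bigr => i _; rewrite big_map.
have svsq i : \sum_(v <- s i) vsq v = 1 by rewrite sum_vsq sE tr1.
apply: le_trans (ge_G_concurrence_assist (s := S) (0 : 'I_2) w0 w1 _ _).
- rewrite sumS; apply: ler_sum => i _.
  rewrite -[leLHS]mulr1 -(svsq i) mulr_sumr big_seq [leRHS]big_seq.
  apply: ler_sum => v vs; rewrite vsqZ tangleZ nsqp.
  have [->|pn0] := eqVneq (p i) 0; first by rewrite !mul0r.
  have [v0|vn0] := eqVneq (vsq v) 0; first by rewrite v0 mulr0 mulr0 mul0r.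
  have XT : X i <= p i ^+ 2 * tangle v / (p i * vsq v) ^+ 2.
    have v2 : 0 < vsq v ^+ 2 by rewrite lt_neqAle eq_sym sqrf_eq0 vn0 sqr_ge0.
    rewrite exprMn -mulf_div divff ?sqrf_eq0// mul1r ler_pdivlMr//.
    by rewrite mulrC; exact: sX.
  rewrite [leLHS]mulrAC; apply: ler_wpM2l.
    by rewrite mulr_ge0 ?vsq_ge0.
  exact: (tangle_G_ndecr w0 w1 (X0 i) XT).
- rewrite sumS; apply: eq_bigr => i _; rewrite -sE scaler_sumr.
  by apply: eq_bigr => v _; rewrite ket_braZ nsqp.
- rewrite sumS -[RHS]p1; apply: eq_bigr => i _.
  rewrite -[RHS]mulr1 -(svsq i) mulr_sumr.
  by apply: eq_bigr => v _; rewrite vsqZ nsqp.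
Qed.

Theorem theorem2 (R : realType) (w : R)
    (hw : 85798%:R / 10 ^+ 5 <= w <= 1)
    (N : nat) (hN : (2 <= N)%N)
    (rho : 'M[R[i]]_(2 * qdim N.-1)) (hrho : density rho) :
  G_concurrence_assist w rho
    <= \sum_(j < N.-1) G_concurrence_assist w (reduced_AB rho j).
Proof.
have /andP[wlo w1] := hw.
have w0 : 0 < w by apply: lt_le_trans wlo; rewrite divr_gt0// exprn_gt0.
set S := \sum_(j < _) _.
have S0 : 0 <= S by apply: sumr_ge0 => j _; exact: G_concurrence_assist_ge0.
rewrite /G_concurrence_assist.
set A := [set s : R | _].
(* The supremum of the empty set is 0 by default. *)
have [->|An0] := eqVneq A set0; first by rewrite sup0.
apply: ge_sup; first exact/set0P.
move=> _ [k [p [phi [[p0 p1 phi1 rhoE] ->]]]].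
have phi1' i : vsq (phi i) = 1 by apply/unit_vectorP.
pose X i j := \sum_e \sum_e' nsq (bitform (col e (AB_amplitudes (phi i) j))
                                         (col e' (AB_amplitudes (phi i) j))).
have X0 i j : 0 <= X i j.
  by apply: sumr_ge0 => e _; apply: sumr_ge0 => e' _; exact: nsq_ge0.
(* The pure-state inequality, averaged over the members of the decomposition. *)
apply: le_trans (_ : \sum_i p i * \sum_j tangle_G w (X i j) <= _).
  apply: ler_sum => i _; apply: ler_wpM2l; first exact: p0.
  have [t1 ->] := G_concurrence_tangle w (phi1' i).
  apply: le_trans (tangle_G_sum w0 w1 _ (X0 i)).
  exact: tangle_G_ndecr (tangle_ge0 _) (tangle_le_sum_AB _).
under eq_bigr do rewrite mulr_sumr.
rewrite exchange_big/=; apply: ler_sum => j _.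
have trij i : \tr (reduced_AB (ket_bra (phi i)) j) = 1.
  by rewrite mxtrace_reduced_AB phi1'.
have dec i : exists s : seq 'cV[R[i]]_(2 * 2),
    \sum_(v <- s) ket_bra v = reduced_AB (ket_bra (phi i)) j /\
    forall v, v \in s -> vsq v ^+ 2 * X i j <= tangle v.
  have [|s sE sX] := @high_tangle_decomposition R _ (AB_amplitudes (phi i) j).
    by rewrite -reduced_AB_ket_bra trij.
  by exists s; rewrite reduced_AB_ket_bra.
have [s sP] := boolp.choice dec.
rewrite rhoE reduced_AB_sum.
apply: (@mixture_le_assist R w k p (X^~ j) _ s) => // i.
- by have [] := sP i.
- by have [_] := sP i.
Qed.
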